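(* For every transcription category $C$ and every localisable semigroup $S$, $\mathscr{C}(\mathscr{S}(C)) = C$ (as transcription categories) and $\mathscr{S}(\mathscr{C}(S)) = S$ (as localisable semigroups).
   Context: A (small) category is a system $(C,\circ,+,-)$, where $C$ is a set, $\circ$ is a partially defined binary operation on $C$, and $x\mapsto x^{+}$, $x\mapsto x^{-}$ are unary maps $C\to C$, such that for all $x,y,z\in C$: (a) $x^{+}\circ x = x = x\circ x^{-}$; (b) $(x^{+})^{-}=x^{+}$ and $(x^{-})^{+}=x^{-}$; (c) $x\circ y$ is defined precisely when $x^{-}=y^{+}$; (d) when $x^{-}=y^{+}$, $(x\circ y)^{+}=x^{+}$ and $(x\circ y)^{-}=y^{-}$; (e) $(x\circ y)\circ z = x\circ(y\circ z)$ whenever the products are defined. The set of identities (objects) is $C^{+}=\{e\in C: e=e^{+}\}$ (which equals $\{e\in C : e=e^-\}$). A transcription category is a category $(C,\circ,+,-)$ together with two transcription maps, assigning to each $e\in C^{+}$ and $x\in C$ elements ${}_{e}|x\in C$ and $x|_{e}\in C$, such that for all $e,f\in C^{+}$ and $x,y\in C$: (a) ${}_{e}|f = e|_{f}$; (b) ${}_{x^{+}}|x = x = x|_{x^{-}}$; (c) ${}_{e}|({}_{f}|x) = {}_{({}_{e}|f)}|x$ and $x|_{(e|_{f})} = (x|_{e})|_{f}$; (d) whenever $x\circ y$ is defined, ${}_{e}|(x\circ y) = ({}_{e}|x)\circ({}_{({}_{e}|x)^{-}}|y)$ and $(x\circ y)|_{f} = (x|_{(y|_{f})^{+}})\circ(y|_{f})$;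 (e) $({}_{e}|x)^{+} = {}_{e}|x^{+}$ and $(x|_{f})^{-} = x^{-}|_{f}$; (f) $({}_{e}|x)|_{f} = {}_{e}|(x|_{f})$. A localisable semigroup is an algebra $(S,\cdot,+,-)$ of signature $(2,1,1)$ such that $(S,\cdot)$ is a semigroup and for all $x,y\in S$: (a) $x^{+}x=x$; (b) $(xy)^{+}=(xy^{+})^{+}$; (c) $x^{+}y^{+}=(x^{+}y)^{+}$; (d) $xx^{-}=x$; (e) $(xy)^{-}=(x^{-}y)^{-}$; (f) $x^{-}y^{-}=(xy^{-})^{-}$; (g) $(x^{+})^{-}=x^{+}$ and $(x^{-})^{+}=x^{-}$. We write $S^{+}=\{x^{+}:x\in S\}=\{x^{-}:x\in S\}$. For a transcription category $C$, $\mathscr{S}(C)=(C,\otimes,+,-)$ where $x\otimes y = (x|_{y^{+}})\circ({}_{x^{-}}|y)$ for all $x,y\in C$ (the composite is always defined), with the same maps $+,-$; it is a localisable semigroup. For a localisable semigroup $S$, $\mathscr{C}(S)=(S,\circ,+,-)$ where the trace product $x\circ y$ is defined exactly when $x^{-}=y^{+}$ and then $x\circ y=x\cdot y$, with the same maps $+,-$ and with transcription maps ${}_{e}|x = e\cdot x$ and $x|_{f}=x\cdot f$ for $x\in S$, $e,f\in S^{+}$; it is a transcription category. *)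

(* Defs.v *)
From Stdlib Require Import ssreflect ssrfun ssrbool.
From Stdlib Require Import ClassicalEpsilon ProofIrrelevance.

Set Implicit Arguments.
Unset Strict Implicit.

(* The partial composition is an option-valued map: [comp x y = Some z] means
   that the composite of x and y is defined and equal to z. *)
Record category : Type := Category {
  carrier :> Type;
  comp : carrier -> carrier -> option carrier;
  cplus : carrier -> carrier;
  cminus : carrier -> carrier;
  comp_plusl : forall x, comp (cplus x) x = Some x;
  comp_minusr : forall x, comp x (cminus x) = Some x;
  cplusK : forall x, cminus (cplus x) = cplus x;
  cminusK : forall x, cplus (cminus x) = cminus x;
  comp_defined : forall x y,
    (exists z, comp x y = Some z) <-> cminus x = cplus y;
  cplus_comp : forall x y z, comp x y = Some z -> cplus z = cplus x;
  cminus_comp : forall x y z, comp x y = Some z -> cminus z = cminus y;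
  comp_assoc : forall x y z xy yz,
    comp x y = Some xy -> comp y z = Some yz -> comp xy z = comp x yz
}.

Arguments comp {c} x y.
Arguments cplus {c} x.
Arguments cminus {c} x.

Definition identity (C : category) : Type := {e : C | e = cplus e}.

Definition ival (C : category) (e : identity C) : C := proj1_sig e.
Coercion ival : identity >-> carrier.

Lemma ival_inj (C : category) (e f : identity C) : ival e = ival f -> e = f.
Proof.
case: e f => [e he] [f hf] /= efE; subst f.
by rewrite (proof_irrelevance _ he hf).
Qed.

Lemma cplus_cplus (C : category) (x : C) : cplus x = cplus (cplus x).
Proof. by rewrite -[in RHS](cplusK x) cminusK cplusK. Qed.

Lemma cplus_id (C : category) (e : identity C) : cplus (ival e) = e.
Proof. by case: e => [e he]. Qed.

Lemma cminus_id (C : category) (e : identity C) : cminus (ival e) = e.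
Proof. by rewrite -[in LHS](cplus_id e) cplusK cplus_id. Qed.

Definition idplus (C : category) (x : C) : identity C :=
  exist _ (cplus x) (cplus_cplus x).

Definition idminus (C : category) (x : C) : identity C :=
  exist _ (cminus x) (esym (cminusK x)).

(* [ltr e x] is e|x and [rtr x e] is x|e.  In [ltr_ltr] and [rtr_rtr] the
   element e|f is used as an index, so it is presented as the identity g whose
   underlying element is e|f; such a g exists since, by [cplus_ltr],
   (e|f)^+ = e|f^+ = e|f (see [ltr_id] below). *)
Record transcription_category : Type := TranscriptionCategory {
  category_of_tc :> category;
  ltr : identity category_of_tc -> category_of_tc -> category_of_tc;
  rtr : category_of_tc -> identity category_of_tc -> category_of_tc;
  ltr_rtr_id : forall e f : identity category_of_tc, ltr e f = rtr e f;
  ltr_plus : forall x, ltr (idplus x) x = x;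
  rtr_minus : forall x, rtr x (idminus x) = x;
  ltr_ltr : forall (e f g : identity category_of_tc) x,
    ival g = ltr e f -> ltr e (ltr f x) = ltr g x;
  rtr_rtr : forall (e f g : identity category_of_tc) x,
    ival g = rtr e f -> rtr x g = rtr (rtr x e) f;
  ltr_comp : forall e x y xy, comp x y = Some xy ->
    comp (ltr e x) (ltr (idminus (ltr e x)) y) = Some (ltr e xy);
  rtr_comp : forall f x y xy, comp x y = Some xy ->
    comp (rtr x (idplus (rtr y f))) (rtr y f) = Some (rtr xy f);
  cplus_ltr : forall e x, cplus (ltr e x) = ltr e (cplus x);
  cminus_rtr : forall f x, cminus (rtr x f) = rtr (cminus x) f;
  ltr_rtr : forall e f x, rtr (ltr e x) f = ltr e (rtr x f)
}.

Arguments ltr {t} e x.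
Arguments rtr {t} x e.

Record localisable_semigroup : Type := LocalisableSemigroup {
  scarrier :> Type;
  smul : scarrier -> scarrier -> scarrier;
  splus : scarrier -> scarrier;
  sminus : scarrier -> scarrier;
  smulA : forall x y z, smul x (smul y z) = smul (smul x y) z;
  smul_plusl : forall x, smul (splus x) x = x;
  splus_mulr : forall x y, splus (smul x y) = splus (smul x (splus y));
  smul_plus_plus : forall x y, smul (splus x) (splus y) = splus (smul (splus x) y);
  smul_minusr : forall x, smul x (sminus x) = x;
  sminus_mull : forall x y, sminus (smul x y) = sminus (smul (sminus x) y);
  smul_minus_minus : forall x y,
    smul (sminus x) (sminus y) = sminus (smul x (sminus y));
  splusK : forall x, sminus (splus x) = splus x;
  sminusK : forall x, splus (sminus x) = sminus x
}.

Arguments smul {l} x y.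
Arguments splus {l} x.
Arguments sminus {l} x.

Section SemigroupOfCategory.
Variable C : transcription_category.
Implicit Types (x y z : C) (e f g : identity C).

Lemma ltr_id e f : ltr e f = cplus (ltr e f).
Proof. by rewrite cplus_ltr cplus_id. Qed.

Definition idmul e f : identity C := exist _ (ltr e f) (ltr_id e f).

Lemma ltrM e f x : ltr e (ltr f x) = ltr (idmul e f) x.
Proof. exact: ltr_ltr. Qed.

Lemma rtrM e f x : rtr (rtr x e) f = rtr x (idmul e f).
Proof. by symmetry; apply: rtr_rtr; rewrite -ltr_rtr_id. Qed.

Lemma idmulA e f g : idmul e (idmul f g) = idmul (idmul e f) g.
Proof. by apply: ival_inj; rewrite /= ltrM. Qed.

Lemma idmulee e : idmul e e = e.
Proof.
apply: ival_inj; rewrite /= -[X in ltr X _](_ : idplus (ival e) = e) ?ltr_plus //.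
by apply: ival_inj; rewrite /= cplus_id.
Qed.

Lemma idplus_ltr e x : idplus (ltr e x) = idmul e (idplus x).
Proof. by apply: ival_inj; rewrite /= cplus_ltr. Qed.

Lemma idminus_rtr f x : idminus (rtr x f) = idmul (idminus x) f.
Proof.
by apply: ival_inj; rewrite /= cminus_rtr -[cminus x]/(ival (idminus x))
  -ltr_rtr_id.
Qed.

Lemma tensor_defined x y :
  cminus (rtr x (idplus y)) = cplus (ltr (idminus x) y).
Proof.
rewrite -[LHS]/(ival (idminus _)) -[RHS]/(ival (idplus _)).
by rewrite idminus_rtr idplus_ltr.
Qed.

Lemma comp_sig x y : cminus x = cplus y -> {z : C | comp x y = Some z}.
Proof.
move/comp_defined; case: (comp x y) => [z _|h]; first by exists z.
by exfalso; case: h.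
Defined.

Definition tensor x y : C := proj1_sig (comp_sig (tensor_defined x y)).

Lemma tensorE x y :
  comp (rtr x (idplus y)) (ltr (idminus x) y) = Some (tensor x y).
Proof. exact: proj2_sig (comp_sig (tensor_defined x y)). Qed.

Lemma tensor_eq x y z :
  comp (rtr x (idplus y)) (ltr (idminus x) y) = Some z -> tensor x y = z.
Proof. by rewrite tensorE => -[]. Qed.

Lemma cplus_tensor x y : cplus (tensor x y) = cplus (rtr x (idplus y)).
Proof. exact: cplus_comp (tensorE x y). Qed.

Lemma cminus_tensor x y : cminus (tensor x y) = cminus (ltr (idminus x) y).
Proof. exact: cminus_comp (tensorE x y). Qed.

Lemma idplus_eq x y : cplus x = cplus y -> idplus x = idplus y.
Proof. by move=> h; apply: ival_inj. Qed.

Lemma idminus_eq x y : cminus x = cminus y -> idminus x = idminus y.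
Proof. by move=> h; apply: ival_inj. Qed.

Lemma idplus_plus x : idplus (cplus x) = idplus x.
Proof. by apply: idplus_eq; rewrite -cplus_cplus. Qed.

Lemma idminus_plus x : idminus (cplus x) = idplus x.
Proof. by apply: ival_inj; rewrite /= cplusK. Qed.

Lemma idplus_minus x : idplus (cminus x) = idminus x.
Proof. by apply: ival_inj; rewrite /= cminusK. Qed.

Lemma idminus_minus x : idminus (cminus x) = idminus x.
Proof. by apply: ival_inj; rewrite /= -[in LHS](cminusK x) cplusK cminusK. Qed.

Lemma rtr_absorb x y f :
  rtr (rtr x (idplus y)) (idmul (idminus x) (idplus (rtr y f))) =
  rtr x (idplus (rtr y f)).
Proof.
have yE : idplus (rtr y f) = idmul (idplus y) (idplus (rtr y f)).
  by rewrite -idplus_ltr -ltr_rtr ltr_plus.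
rewrite rtrM -{1}(rtr_minus x) rtrM yE.
set p := idminus x; set q := idplus y; set r := idplus _.
have -> : idmul p (idmul q (idmul p (idmul q r))) = idmul p (idmul q r).
  by rewrite !idmulA -(idmulA (idmul p q) p q) idmulee.
by rewrite -rtrM rtr_minus.
Qed.

Lemma ltr_absorb e y z :
  ltr (idmul (idminus (ltr e y)) (idplus z)) (ltr (idminus y) z) =
  ltr (idminus (ltr e y)) z.
Proof.
have yE : idminus (ltr e y) = idmul (idminus (ltr e y)) (idminus y).
  by rewrite -idminus_rtr ltr_rtr rtr_minus.
rewrite -{2}(ltr_plus z) !ltrM yE.
set p := idminus (ltr e y); set q := idminus y; set r := idplus z.
have -> : idmul (idmul (idmul (idmul p q) r) q) r = idmul (idmul p q) r.
  by rewrite -!idmulA (idmulA q r (idmul q r)) idmulee.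
by rewrite -[LHS]ltrM ltr_plus.
Qed.

Lemma tensorA x y z : tensor x (tensor y z) = tensor (tensor x y) z.
Proof.
set t := ltr (idminus x) y; set w := rtr y (idplus z).
have mE : rtr t (idplus z) = ltr (idminus x) w by exact: ltr_rtr.
have h1 := ltr_comp (idminus x) (tensorE y z).
have h2 := rtr_comp (idplus z) (tensorE x y).
rewrite -/w -/t mE in h1 h2.
rewrite idplus_ltr rtr_absorb -/w in h2.
rewrite -mE idminus_rtr ltr_absorb -/t mE in h1.
apply: tensor_eq.
rewrite (idplus_eq (cplus_tensor y z)) -/w -(comp_assoc h2 h1).
rewrite (idminus_eq (esym (cminus_tensor x y))).
exact: tensorE.
Qed.

Lemma tensor_plusl x : tensor (cplus x) x = x.
Proof.
apply: tensor_eq; rewrite idminus_plus -{1}idminus_plus rtr_minus ltr_plus.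
exact: comp_plusl.
Qed.

Lemma tensor_minusr x : tensor x (cminus x) = x.
Proof.
apply: tensor_eq; rewrite idplus_minus rtr_minus -idplus_minus ltr_plus.
exact: comp_minusr.
Qed.

Lemma tensor_id e f : tensor e f = ltr e f.
Proof.
apply: tensor_eq.
have -> : idplus (ival f) = f by apply: ival_inj; exact: cplus_id.
have -> : idminus (ival e) = e by apply: ival_inj; exact: cminus_id.
by rewrite -ltr_rtr_id [X in comp X _]ltr_id comp_plusl.
Qed.

Lemma cplus_tensorr x y : cplus (tensor x y) = cplus (tensor x (cplus y)).
Proof. by rewrite !cplus_tensor idplus_plus. Qed.

Lemma cminus_tensorl x y : cminus (tensor x y) = cminus (tensor (cminus x) y).
Proof. by rewrite !cminus_tensor idminus_minus. Qed.

Lemma tensor_plus_plus x y :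
  tensor (cplus x) (cplus y) = cplus (tensor (cplus x) y).
Proof.
rewrite -[cplus x]/(ival (idplus x)) -[cplus y]/(ival (idplus y)).
by rewrite tensor_id cplus_tensor -ltr_rtr_id -ltr_id.
Qed.

Lemma tensor_minus_minus x y :
  tensor (cminus x) (cminus y) = cminus (tensor x (cminus y)).
Proof.
rewrite -[cminus x]/(ival (idminus x)) -[cminus y]/(ival (idminus y)).
rewrite tensor_id cminus_tensor.
exact: esym (cminus_id (idmul (idminus x) (idminus y))).
Qed.

Definition semigroup_of_category : localisable_semigroup :=
  LocalisableSemigroup tensorA tensor_plusl cplus_tensorr tensor_plus_plus
    tensor_minusr cminus_tensorl tensor_minus_minus
    (@cplusK C) (@cminusK C).

End SemigroupOfCategory.

Section CategoryOfSemigroup.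
Variable S : localisable_semigroup.
Implicit Types x y z : S.

Definition trace x y : option S :=
  if excluded_middle_informative (sminus x = splus y)
  then Some (smul x y) else None.

Lemma traceT x y : sminus x = splus y -> trace x y = Some (smul x y).
Proof. by rewrite /trace; case: excluded_middle_informative. Qed.

Lemma traceP x y z :
  trace x y = Some z -> sminus x = splus y /\ z = smul x y.
Proof. by rewrite /trace; case: excluded_middle_informative => // h [<-]. Qed.

Lemma trace_plusl x : trace (splus x) x = Some x.
Proof. by rewrite traceT ?smul_plusl // splusK. Qed.

Lemma trace_minusr x : trace x (sminus x) = Some x.
Proof. by rewrite traceT ?smul_minusr // sminusK. Qed.

Lemma trace_defined x y : (exists z, trace x y = Some z) <-> sminus x = splus y.
Proof.
split=> [[z /traceP[]]//|h]; by exists (smul x y); apply: traceT.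
Qed.

Lemma splus_trace x y z : trace x y = Some z -> splus z = splus x.
Proof.
by move=> /traceP[h ->]; rewrite splus_mulr -h smul_minusr.
Qed.

Lemma sminus_trace x y z : trace x y = Some z -> sminus z = sminus y.
Proof.
by move=> /traceP[h ->]; rewrite sminus_mull h smul_plusl.
Qed.

Lemma trace_assoc x y z xy yz :
  trace x y = Some xy -> trace y z = Some yz -> trace xy z = trace x yz.
Proof.
move=> hxy hyz; have [e1 _] := traceP hxy; have [e2 _] := traceP hyz.
rewrite !traceT ?(splus_trace hyz) ?(sminus_trace hxy) //.
have [_ ->] := traceP hxy; have [_ ->] := traceP hyz; by rewrite smulA.
Qed.

Definition trace_category : category :=
  Category trace_plusl trace_minusr (@splusK S) (@sminusK S)
    trace_defined splus_trace sminus_trace trace_assoc.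

(* The identities of the trace category are the elements of S^+. *)
Lemma splus_range x : x = splus x <-> exists y, x = splus y.
Proof.
split=> [h|[y ->]]; first by exists x.
exact: (@cplus_cplus trace_category y).
Qed.

Lemma sminus_range x : x = splus x <-> exists y, x = sminus y.
Proof.
split=> [h|[y ->]]; last by rewrite sminusK.
by exists x; rewrite [in RHS]h splusK.
Qed.

Implicit Types e f g : identity trace_category.

Definition mul_ltr e x : S := smul (ival e) x.
Definition mul_rtr x f : S := smul x (ival f).

Lemma splus_id e : splus (ival e : S) = ival e.
Proof. exact: (cplus_id e). Qed.

Lemma sminus_id e : sminus (ival e : S) = ival e.
Proof. exact: (cminus_id e). Qed.

Lemma mul_ltr_rtr_id e f : mul_ltr e (ival f) = mul_rtr (ival e) f.
Proof. by []. Qed.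

Lemma mul_ltr_plus x : mul_ltr (@idplus trace_category x) x = x.
Proof. exact: smul_plusl. Qed.

Lemma mul_rtr_minus x : mul_rtr x (@idminus trace_category x) = x.
Proof. exact: smul_minusr. Qed.

Lemma mul_ltr_ltr e f g x :
  ival g = mul_ltr e (ival f) -> mul_ltr e (mul_ltr f x) = mul_ltr g x.
Proof. by rewrite /mul_ltr => ->; rewrite smulA. Qed.

Lemma mul_rtr_rtr e f g x :
  ival g = mul_rtr (ival e) f -> mul_rtr x g = mul_rtr (mul_rtr x e) f.
Proof. by rewrite /mul_rtr => ->; rewrite smulA. Qed.

Lemma splus_mul_ltr e x : splus (mul_ltr e x) = mul_ltr e (splus x).
Proof. by rewrite /mul_ltr -[in RHS]splus_id smul_plus_plus splus_id. Qed.

Lemma sminus_mul_rtr f x : sminus (mul_rtr x f) = mul_rtr (sminus x) f.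
Proof. by rewrite /mul_rtr -[in RHS]sminus_id smul_minus_minus sminus_id. Qed.

Lemma mul_ltr_comp e x y xy : trace x y = Some xy ->
  trace (mul_ltr e x) (mul_ltr (@idminus trace_category (mul_ltr e x)) y) =
  Some (mul_ltr e xy).
Proof.
move=> /traceP[h ->]; rewrite traceT.
  rewrite splus_mul_ltr -h /mul_ltr /= smul_minus_minus.
  by rewrite -smulA smul_minusr.
by rewrite /mul_ltr /= smulA smul_minusr smulA.
Qed.

Lemma mul_rtr_comp f x y xy : trace x y = Some xy ->
  trace (mul_rtr x (@idplus trace_category (mul_rtr y f))) (mul_rtr y f) =
  Some (mul_rtr xy f).
Proof.
move=> /traceP[h ->]; rewrite traceT.
  rewrite sminus_mul_rtr h /mul_rtr /= smul_plus_plus.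
  by rewrite smulA smul_plusl.
by rewrite /mul_rtr /= -smulA smul_plusl smulA.
Qed.

Lemma mul_ltr_rtr e f x : mul_rtr (mul_ltr e x) f = mul_ltr e (mul_rtr x f).
Proof. by rewrite /mul_ltr /mul_rtr smulA. Qed.

Definition category_of_semigroup : transcription_category :=
  @TranscriptionCategory trace_category mul_ltr mul_rtr
    mul_ltr_rtr_id mul_ltr_plus mul_rtr_minus mul_ltr_ltr mul_rtr_rtr
    mul_ltr_comp mul_rtr_comp splus_mul_ltr sminus_mul_rtr mul_ltr_rtr.

End CategoryOfSemigroup.

(* Main.v *)
From Stdlib Require Import ssreflect ssrfun ssrbool.
From Stdlib Require Import ClassicalEpsilon ProofIrrelevance.
From Stdlib Require Import FunctionalExtensionality.
Require Import Defs.

(** The two constructions keep the underlying set and the maps [+] and [-], so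
    what has to be compared is the product, the composition and the two
    transcriptions.

    Starting from a category: if x^- = y^+ then the transcriptions in
    x (x) y = (x|y^+) o (x^-|y) are trivial, so (x) restricted to such pairs is
    o ([comp_tensor]).  If e is an identity, then e|x^+ = (e|x)^+, so that
    e (x) x = (e|x)^+ o (e|x) = e|x ([tensor_ltr]), and dually on the right
    ([tensor_rtr]).

    Starting from a semigroup: the product rebuilt from the trace product is
    x y^+ x^- y, and it equals xy because x^- y^+ is an idempotent which can be
    inserted between x and y ([smul_mid]).

    Both conclusions are equalities of structures, not isomorphisms.  A
    structure is determined by its operations, since two proofs of the same
    axiom are equal ([transcription_category_eq], [localisable_semigroup_eq]);
    the operations, in turn, are compared pointwise. *)

Set Implicit Arguments.
Unset Strict Implicit.

(** * Structures are determined by their operations *)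

(** Once the operations agree, the two copies of each axiom are proofs of one
    proposition.  The axioms on the transcriptions mention those of the
    underlying category, so they only become the same proposition after the
    latter have been merged; hence the iteration. *)
Ltac identify_proofs :=
  repeat match goal with
  | H : ?A, H' : ?A |- _ =>
      have ? := proof_irrelevance A H H'; subst H'
  end.

(** The transcriptions are indexed by the fixed points of [+], without reference
    to the category axioms.  Hence the operations of two categories with the
    same [+] have the same type, and no transport is needed to compare them. *)
Record transcription_ops : Type := TranscriptionOps {
  tcar : Type;
  tcomp : tcar -> tcar -> option tcar;
  tplus : tcar -> tcar;
  tminus : tcar -> tcar;
  tltr : {e : tcar | e = tplus e} -> tcar -> tcar;
  trtr : tcar -> {e : tcar | e = tplus e} -> tcar
}.

Definition ops_of_category (C : transcription_category) : transcription_ops :=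
  @TranscriptionOps C comp cplus cminus ltr rtr.

(** An equation between records with dependent fields yields equations between
    dependent pairs, which proof irrelevance turns into equations between the
    fields. *)
Lemma transcription_category_eq (C D : transcription_category) :
  ops_of_category C = ops_of_category D -> C = D.
Proof.
case: C => [[T c p m ? ? ? ? ? ? ? ?] l r ? ? ? ? ? ? ? ? ? ?].
case: D => [[T' c' p' m' ? ? ? ? ? ? ? ?] l' r' ? ? ? ? ? ? ? ? ? ?].
rewrite /ops_of_category /= => opsE; inversion opsE; subst T'.
repeat match goal with
| H : existT _ _ _ = existT _ _ _ |- _ => apply inj_pair2 in H; subst
end.
by clear opsE; identify_proofs.
Qed.

Record semigroup_ops : Type := SemigroupOps {
  scar : Type;
  sgmul : scar -> scar -> scar;
  sgplus : scar -> scar;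
  sgminus : scar -> scar
}.

Definition ops_of_semigroup (S : localisable_semigroup) : semigroup_ops :=
  @SemigroupOps S smul splus sminus.

Lemma localisable_semigroup_eq (S T : localisable_semigroup) :
  ops_of_semigroup S = ops_of_semigroup T -> S = T.
Proof.
case: S => [S m p n ? ? ? ? ? ? ? ? ?].
case: T => [T m' p' n' ? ? ? ? ? ? ? ? ?].
rewrite /ops_of_semigroup /= => opsE; inversion opsE; subst T.
repeat match goal with
| H : existT _ _ _ = existT _ _ _ |- _ => apply inj_pair2 in H; subst
end.
by clear opsE; identify_proofs.
Qed.

(** * From a category to its semigroup and back *)

Section CategoryRoundTrip.
Variable C : transcription_category.
Implicit Types (x y : C) (e f : identity C).

Lemma comp_tensor x y : cminus x = cplus y -> comp x y = Some (tensor x y).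
Proof.
move=> xy; have xyE : idplus y = idminus x by apply: ival_inj.
by rewrite -tensorE xyE rtr_minus -xyE ltr_plus.
Qed.

Lemma trace_tensor x y : @trace (semigroup_of_category C) x y = comp x y.
Proof.
rewrite /trace; case: excluded_middle_informative => [/comp_tensor->|] //= nxy.
case xyE: (comp x y) => [z|] //.
by case: nxy; apply/comp_defined; exists z.
Qed.

Lemma idminus_ival e : idminus (ival e) = e.
Proof. by apply: ival_inj; exact: cminus_id. Qed.

Lemma idplus_ival e : idplus (ival e) = e.
Proof. by apply: ival_inj; exact: cplus_id. Qed.

Lemma tensor_ltr e x : tensor e x = ltr e x.
Proof.
apply: tensor_eq; rewrite idminus_ival -ltr_rtr_id /= -cplus_ltr.
exact: comp_plusl.
Qed.

Lemma tensor_rtr x f : tensor x f = rtr x f.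
Proof.
apply: tensor_eq; rewrite idplus_ival ltr_rtr_id /= -cminus_rtr.
exact: comp_minusr.
Qed.

Lemma category_round_trip :
  category_of_semigroup (semigroup_of_category C) = C.
Proof.
apply: transcription_category_eq; rewrite /ops_of_category /=.
congr (@TranscriptionOps C _ cplus cminus _ _).
- apply: functional_extensionality => x; apply: functional_extensionality => y.
  exact: trace_tensor.
- apply: functional_extensionality => e; apply: functional_extensionality => x.
  exact: tensor_ltr.
- apply: functional_extensionality => x; apply: functional_extensionality => f.
  exact: tensor_rtr.
Qed.

End CategoryRoundTrip.

(** * From a semigroup to its category and back *)

Section SemigroupRoundTrip.
Variable S : localisable_semigroup.
Implicit Types x y : S.

(** With e = x^- y^+, a member of S^+ and so an idempotent, the left side is
    x e e y = x e y, and this is xy since x = x x^- and y = y^+ y. *)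
Lemma smul_mid x y :
  smul (smul x (splus y)) (smul (sminus x) y) = smul x y.
Proof.
set e := smul (sminus x) (splus y).
have eP : e = splus e.
  apply/splus_range; exists (smul (sminus x) y).
  by rewrite /e -[sminus x]sminusK smul_plus_plus.
have ee : smul e e = e by rewrite {1}eP smul_plusl.
have xE : smul x (splus y) = smul x e by rewrite /e smulA smul_minusr.
have yE : smul (sminus x) y = smul e y by rewrite /e -smulA smul_plusl.
by rewrite xE yE smulA -(smulA x e e) ee -smulA -yE smulA smul_minusr.
Qed.

Lemma tensor_smul x y : @tensor (category_of_semigroup S) x y = smul x y.
Proof.
apply: tensor_eq; rewrite -[RHS]/(Some (smul x y)) -(smul_mid x y).
exact: (traceT (@tensor_defined (category_of_semigroup S) x y)).
Qed.

Lemma semigroup_round_trip :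
  semigroup_of_category (category_of_semigroup S) = S.
Proof.
apply: localisable_semigroup_eq; rewrite /ops_of_semigroup /=.
congr (@SemigroupOps S _ splus sminus).
apply: functional_extensionality => x; apply: functional_extensionality => y.
exact: tensor_smul.
Qed.

End SemigroupRoundTrip.

Theorem theorem4p7 (C : transcription_category) (S : localisable_semigroup) :
  category_of_semigroup (semigroup_of_category C) = C /\
  semigroup_of_category (category_of_semigroup S) = S.
Proof. by split; [exact: category_round_trip | exact: semigroup_round_trip]. Qed.
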